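(* Let $p,q$ be primes such that $p\equiv 1\pmod q$ (the case $q=2$ is allowed), let $g$ be a fixed element of order $q$ in $\mathbb{Z}_p^\times$, and let $\mathfrak{B}\subseteq\mathbb{Z}_q$ be the set of parameters defined in the context. Up to isomorphism, the left braces with additive group isomorphic to $\mathbb{Z}_p^2\times\mathbb{Z}_q$ and with $|\ker\lambda|=p^2$ are exactly the braces $B_s$ for $s\in\mathfrak{B}$, distinct $s$ giving non-isomorphic braces, where $B_s=(\mathbb{Z}_p\times\mathbb{Z}_p\times\mathbb{Z}_q,+,\circ)$ with $$\begin{pmatrix} x_1\\ x_2\\ x_3\end{pmatrix}+\begin{pmatrix} y_1\\ y_2\\ y_3\end{pmatrix}=\begin{pmatrix} x_1+y_1\\ x_2+y_2\\ x_3+y_3\end{pmatrix},\qquad \begin{pmatrix} x_1\\ x_2\\ x_3\end{pmatrix}\circ\begin{pmatrix} y_1\\ y_2\\ y_3\end{pmatrix}=\begin{pmatrix} x_1+g^{x_3}y_1\\ x_2+(g^s)^{x_3}y_2\\ x_3+y_3\end{pmatrix}$$ for all $x_1,x_2,y_1,y_2\in\mathbb{Z}_p$ and $x_3,y_3\in\mathbb{Z}_q$. In particular, $(B_s,\circ)\cong\mathcal{G}_s$ and $B_s$ is a bi-skew brace.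
   Context: A skew (left) brace is a triple $(B,+,\circ)$ where $(B,+)$ and $(B,\circ)$ are groups such that $a\circ(b+c)=a\circ b-a+a\circ c$ for all $a,b,c\in B$; it is a left brace if $(B,+)$ is abelian, and a bi-skew brace if $(B,\circ,+)$ is also a skew brace. The map $\lambda:(B,\circ)\to\mathrm{Aut}(B,+)$, $\lambda_a(b)=-a+a\circ b$, is a group homomorphism, with kernel $\ker\lambda$. Isomorphisms are bijections preserving both operations. $\mathfrak{B}$ denotes a fixed subset of $\mathbb{Z}_q$ containing $0,1,-1$ and exactly one out of $k$ and $k^{-1}$ for each $k\in\mathbb{Z}_q$, $k\neq 0,1,-1$; for $q=2$, $\mathfrak{B}=\{0,1\}$. For $k\in\mathbb{Z}_q$, $\mathcal{G}_k=\langle\sigma,\tau,\epsilon\mid\sigma^p=\tau^p=\epsilon^q=1,\ [\sigma,\tau]=1,\ \epsilon\sigma\epsilon^{-1}=\sigma^g,\ \epsilon\tau\epsilon^{-1}=\tau^{g^k}\rangle\cong\mathbb{Z}_p^2\rtimes\mathbb{Z}_q$. *)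

(* Defs.v *)
From HB Require Import structures.
From mathcomp Require Import all_boot all_order all_algebra all_fingroup.

Set Implicit Arguments.
Unset Strict Implicit.
Unset Printing Implicit Defensive.

Import GRing.Theory.
Local Open Scope ring_scope.

(* The compatibility condition a o (b + c) = a o b - a + a o c, for operations
   that need not be commutative; a skew brace consists of two group structures
   on one carrier satisfying this law. *)
Definition skew_brace_law (B : Type) (add : B -> B -> B) (opp : B -> B)
    (circ : B -> B -> B) : Prop :=
  forall a b c : B, circ a (add b c) = add (add (circ a b) (opp a)) (circ a c).

(* The group (B, +) is abelian, hence a zmodType, and (B, o) is a groupType:
   a o b is written (a * b)%g. *)
HB.mixin Record Zmodule_Group_isLeftBrace B of GRing.Zmodule B & monoid.Group B := {
  circ_addr : @skew_brace_law B +%R -%R *%g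
}.

#[short(type="leftBraceType")]
HB.structure Definition LeftBrace :=
  {B of GRing.Zmodule B & monoid.Group B & Zmodule_Group_isLeftBrace B}.

(* (B, o, +) is a skew brace too. *)
Definition bi_skew (B : leftBraceType) : Prop :=
  @skew_brace_law B *%g (fun a => a^-1%g) +%R.

Definition lambda (B : leftBraceType) (a b : B) : B := - a + (a * b)%g.

(* A brace is not assumed to be finite, so the cardinality of the kernel
   {a | lambda_a = id} is given by a duplicate-free enumeration. *)
Definition card_ker_lambda (B : leftBraceType) (n : nat) : Prop :=
  exists K : seq B,
    [/\ uniq K, size K = n & forall a : B, a \in K <-> lambda a =1 id].

Definition zmod_isom (U V : zmodType) : Prop :=
  exists f : {additive U -> V}, bijective f.

Definition brace_isom (B C : leftBraceType) : Prop :=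
  exists f : B -> C,
    [/\ bijective f, {morph f : a b / a + b} & {morph f : a b / (a * b)%g}].

(* The sets of parameters: K contains 0, 1, -1 and exactly one of k and k^-1
   for any other k (for q = 2 this forces K = {0, 1}). *)
Definition parameter_set (q : nat) (K : {set 'F_q}) : Prop :=
  [/\ 0 \in K, 1 \in K, -1 \in K &
      forall k : 'F_q, k != 0 -> k != 1 -> k != -1 ->
        (k \in K) (+) (k^-1 \in K)].

(* G is isomorphic to the group G_k with this presentation; since G_k is finite,
   it is its own largest finite quotient, which is what Grp describes.
   Exponents in 'F_p and 'F_q are the canonical representatives in nat. *)
Definition isog_G (p q : nat) (g : {unit 'F_p}) (k : 'F_q)
    (gT : finGroupType) (G : {set gT}) : Prop :=
  (G \isog Grp (sigma : tau : eps :
    sigma ^+ p, tau ^+ p, eps ^+ q, [~ sigma, tau],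
    eps * sigma * eps^-1 = sigma ^+ (val g : 'F_p)%R,
    eps * tau * eps^-1 = tau ^+ (val g ^+ k : 'F_p)%R))%g.

(* The group axioms of (B_s, o) require q prime and g of order q; the proofs
   are parameters of the type, so that its instances are canonical. *)
Definition brace_B (p q : nat) (g : {unit 'F_p}) of prime q & #[g]%g = q :=
  fun s : 'F_q => ('F_p * 'F_p * 'F_q)%type.

Section BraceB.

Variables (p q : nat) (g : {unit 'F_p}) (q_pr : prime q) (og : #[g]%g = q).
Variable s : 'F_q.

Local Notation B := (brace_B q_pr og s).

HB.instance Definition _ := GRing.Zmodule.on B.
HB.instance Definition _ := Finite.on B.

Definition B_circ (x y : B) : B :=
  (x.1.1 + val g ^+ x.2 * y.1.1,
   x.1.2 + (val g ^+ s) ^+ x.2 * y.1.2,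
   x.2 + y.2).

Definition B_inv (x : B) : B :=
  (- (val g ^+ (- x.2)%R * x.1.1), - ((val g ^+ s) ^+ (- x.2)%R * x.1.2), - x.2).

Let gX1 : val g ^+ q = 1 :> 'F_p.
Proof. by rewrite -FinRing.val_unitX -og expg_order. Qed.

Let gsX1 : (val g ^+ s) ^+ q = 1 :> 'F_p.
Proof. by rewrite -exprM mulnC exprM gX1 expr1n. Qed.

Let expF (u : 'F_p) (i j : 'F_q) :
  u ^+ q = 1 -> u ^+ (i + j)%R = u ^+ i * u ^+ j.
Proof. by move=> uq; rewrite -exprD -[RHS](expr_mod _ uq) -[X in (_ %% X)%N](Fp_cast q_pr). Qed.

Fact B_circA : associative B_circ.
Proof.
move=> x y z; rewrite /B_circ /= !expF //.
by rewrite !mulrDr !addrA !mulrA.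
Qed.

Fact B_circ0x : left_id (0 : B) B_circ.
Proof. by move=> [[x1 x2] x3]; rewrite /B_circ /= !expr0 !mul1r !add0r. Qed.

Fact B_circx0 : right_id (0 : B) B_circ.
Proof. by move=> [[x1 x2] x3]; rewrite /B_circ /= !mulr0 !addr0. Qed.

Fact B_circVx : left_inverse (0 : B) B_inv B_circ.
Proof. by move=> [[x1 x2] x3]; rewrite /B_circ /= !addNr. Qed.

Fact B_circxV : right_inverse (0 : B) B_inv B_circ.
Proof.
have expK (u y : 'F_p) (i : 'F_q) : u ^+ q = 1 ->
    y + u ^+ i * - (u ^+ (- i)%R * y) = 0.
  by move=> uq; rewrite mulrN mulrA -expF // !subrr expr0 mul1r subrr.
by move=> x; rewrite /B_circ /B_inv !expK // subrr.
Qed.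

HB.instance Definition _ :=
  isGroup.Build B B_circA B_circ0x B_circx0 B_circVx B_circxV.

Fact B_circ_addr : @skew_brace_law B +%R -%R *%g.
Proof.
have law (V : zmodType) (a b c : V) : a + (b + c) = a + b - a + (a + c).
  by rewrite !addrA subrK.
move=> a b c; congr (_, _, _).
- by rewrite [X in _ + X]mulrDr; exact: law.
- by rewrite [X in _ + X]mulrDr; exact: law.
exact: law.
Qed.

HB.instance Definition _ := Zmodule_Group_isLeftBrace.Build B B_circ_addr.


Fact brace_B_addE (x y : B) :
  x + y = (x.1.1 + y.1.1, x.1.2 + y.1.2, x.2 + y.2).
Proof. by []. Qed.

Fact brace_B_circE (x y : B) :
  (x * y)%g = (x.1.1 + val g ^+ x.2 * y.1.1,
               x.1.2 + (val g ^+ s) ^+ x.2 * y.1.2,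
               x.2 + y.2).
Proof. by []. Qed.

End BraceB.

(* Main.v *)
(* Since lambda_a depends on a only modulo ker lambda and a o b = a + b for a in
   the kernel, ker lambda is an additive subgroup of order p^2, i.e. the Sylow
   p-subgroup V = Z_p^2.  Hence lambda is determined by A = lambda_e, where e
   generates Z_q; the image of lambda has order q, so A^q = 1.  On Z_q, A is
   multiplication by some c with c^q = 1, whence c = 1; on V it is diagonalizable
   with eigenvalues g^a, g^b not both 1, because X^q - 1 splits over F_p.
   Replacing e by a^-1 e turns (a, b) into (1, b/a), and swapping the eigenvectors
   inverts the parameter b/a; conversely an isomorphism B_s -> B_t intertwines
   diag(g, g^s) with a power of diag(g, g^t), so that s = t or s t = 1. *)
Require Import Defs.
From HB Require Import structures.
From mathcomp Require Import all_boot all_order all_algebra all_fingroup.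
From mathcomp Require Import cyclic.

Set Implicit Arguments.
Unset Strict Implicit.
Unset Printing Implicit Defensive.

Import GRing.Theory.
Local Open Scope ring_scope.

(** * Exponents taken in a prime field *)

Section PrimeField.

Variables (q : nat) (q_pr : prime q).

Lemma val_Fp_add (i j : 'F_q) : (i + j)%R = ((i + j) %% q)%N :> nat.
Proof. by rewrite -[X in (_ %% X)%N](Fp_cast q_pr). Qed.

Lemma val_Fp_mul (i j : 'F_q) : (i * j)%R = ((i * j) %% q)%N :> nat.
Proof. by rewrite -[X in (_ %% X)%N](Fp_cast q_pr). Qed.

Lemma ltn_Fp (i : 'F_q) : (i < q)%N.
Proof. by rewrite -[X in (_ < X)%N](Fp_cast q_pr). Qed.

Lemma mulrn_Fp (x y : 'F_q) : x *+ y = x * y.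
Proof. by rewrite -mulr_natr natr_Zp. Qed.

Lemma mulrn_Fp_char (x : 'F_q) : x *+ q = 0.
Proof. by rewrite -mulr_natr pchar_Fp_0 ?mulr0. Qed.

Lemma mulrn_Fp_eq0 (x : 'F_q) n : ~~ (q %| n)%N -> x *+ n = 0 -> x = 0.
Proof.
move=> qn /eqP; rewrite -mulr_natr mulf_eq0 -(dvdn_pcharf (pchar_Fp q_pr)).
by rewrite (negPf qn) orbF => /eqP.
Qed.

(** Fermat: the Frobenius map fixes the image of the naturals, which is the whole prime field. *)
Lemma Fp_expn (x : 'F_q) : x ^+ q = x.
Proof.
by rewrite -(natr_Zp x) -(pFrobenius_autE (pchar_Fp q_pr)) pFrobenius_aut_nat.
Qed.

Lemma expg_Fp_add (gT : finGroupType) (x : gT) (i j : 'F_q) :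
  (x ^+ q = 1 -> x ^+ (i + j)%R = x ^+ i * x ^+ j)%g.
Proof. by move=> xq; rewrite val_Fp_add expg_mod // expgD. Qed.

Lemma expg_Fp_mul (gT : finGroupType) (x : gT) (i j : 'F_q) :
  (x ^+ q = 1 -> x ^+ (i * j)%R = (x ^+ i) ^+ j)%g.
Proof. by move=> xq; rewrite val_Fp_mul expg_mod // expgM. Qed.

Variables (R : nzRingType) (u : R) (uq : u ^+ q = 1).

Lemma expr_Fp_add (i j : 'F_q) : u ^+ (i + j)%R = u ^+ i * u ^+ j.
Proof. by rewrite val_Fp_add expr_mod // exprD. Qed.

Lemma expr_Fp_mul (i j : 'F_q) : u ^+ (i * j)%R = (u ^+ i) ^+ j.
Proof. by rewrite val_Fp_mul expr_mod // exprM. Qed.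

Lemma expr_Fp_expn (i : 'F_q) : (u ^+ i) ^+ q = 1.
Proof. by rewrite -exprM mulnC exprM uq expr1n. Qed.

(** The order of [u] divides the prime [q], so it is [q] as soon as [u] is not 1. *)
Lemma prime_prim_root : u != 1 -> q.-primitive_root u.
Proof.
move=> u1; have [m pm mq] := prim_order_exists (prime_gt0 q_pr) uq.
have /orP[/eqP m1 | /eqP m_q] := (primeP q_pr).2 m mq; last by rewrite -m_q.
by have := prim_expr_order pm; rewrite m1 => /eqP; rewrite expr1 (negPf u1).
Qed.

End PrimeField.

Lemma expr_Fp_inj (R : nzRingType) q (z : R) (q_pr : prime q) :
  q.-primitive_root z -> injective (fun i : 'F_q => z ^+ i).
Proof.
move=> zq i j /eqP; rewrite (eq_prim_root_expr zq) !modn_small ?ltn_Fp //.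
by move=> /eqP /val_inj.
Qed.

Lemma expr_Fp_surj (F : fieldType) q (z x : F) (q_pr : prime q) :
  q.-primitive_root z -> x ^+ q = 1 -> exists i : 'F_q, x = z ^+ i.
Proof.
move=> zq /(prim_rootP zq)[i ->]; exists (inord i); rewrite inordK //.
by rewrite Fp_cast.
Qed.

Section Generator.

Variables (p q : nat) (g : {unit 'F_p}) (q_pr : prime q) (og : #[g]%g = q).

Lemma val_expgX1 : val g ^+ q = 1 :> 'F_p.
Proof. by rewrite -FinRing.val_unitX -og expg_order. Qed.

Lemma val_prim_root : q.-primitive_root (val g : 'F_p).
Proof.
apply: prime_prim_root => //; first exact: val_expgX1.
apply/eqP=> g1; have: (1 < #[g]%g)%N by rewrite og prime_gt1.
by rewrite order_gt1 -val_eqE /= g1 eqxx.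
Qed.

End Generator.

(** * Additive maps and the action [lambda] of a left brace *)

Lemma morph_addMn (U V : zmodType) (f : U -> V) n x :
  {morph f : x y / x + y} -> f (x *+ n) = f x *+ n.
Proof.
move=> fD; have f0: f 0 = 0 by apply: (addrI (f 0)); rewrite -fD !addr0.
by elim: n => [|n IHn]; rewrite ?mulr0n // !mulrS fD IHn.
Qed.

Lemma circ_lambda (B : leftBraceType) (a b : B) : (a * b)%g = a + lambda a b.
Proof. by rewrite /lambda addrA subrr add0r. Qed.

Lemma lambdaD (B : leftBraceType) (a : B) : {morph lambda a : b c / b + c}.
Proof. by move=> b c; rewrite /lambda circ_addr !addrA. Qed.

Lemma lambda_inj (B : leftBraceType) (a : B) : injective (lambda a).
Proof. by move=> b c /addrI /mulgI. Qed.

(** After [lambda a b] is added on the left, additivity of [lambda a] turns both sides into -a + a o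
    b o c. *)
Lemma lambdaM (B : leftBraceType) (a b c : B) :
  lambda (a * b)%g c = lambda a (lambda b c).
Proof.
apply: (addrI (lambda a b)); rewrite -lambdaD -circ_lambda.
by rewrite /lambda mulgA !addrA addrK.
Qed.

Lemma triple_mulrn (U V W : zmodType) (x : U * V * W) n :
  x *+ n = (x.1.1 *+ n, x.1.2 *+ n, x.2 *+ n).
Proof. by elim: n => [//|n IHn]; rewrite !mulrS IHn. Qed.

Lemma modn1_ndvd p q : prime q -> p = 1 %[mod q] -> ~~ (q %| p)%N.
Proof.
by move=> q_pr pq; rewrite /dvdn pq modn_small ?prime_gt1.
Qed.

(** * Torsion in Z_p^2 x Z_q *)

Section Torsion.

Variables (p q : nat) (p_pr : prime p) (q_pr : prime q).
Local Notation T := ('F_p * 'F_p * 'F_q)%type.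
Implicit Type x : T.

(** Since [p] is invertible modulo [q], the plane [x.2 = 0] is exactly the [p]-torsion; every
    additive map therefore preserves it. *)
Lemma torsion_p x : ~~ (q %| p)%N -> (x *+ p == 0) = (x.2 == 0).
Proof.
move=> qp; rewrite triple_mulrn !mulrn_Fp_char //.
apply/eqP/eqP=> [[/(mulrn_Fp_eq0 q_pr qp)]|->] //; by rewrite mul0rn.
Qed.

Lemma torsion_q x : ~~ (p %| q)%N -> (x *+ q == 0) = (x.1 == 0).
Proof.
move=> pq; rewrite triple_mulrn !mulrn_Fp_char //.
case: x => [[x1 x2] x3] /=; apply/eqP/eqP=> [|[-> ->]]; last by rewrite !mul0rn.
move=> /eqP; rewrite !xpair_eqE => /andP[/andP[/eqP x1q /eqP x2q] _].
by rewrite (mulrn_Fp_eq0 p_pr pq x1q) (mulrn_Fp_eq0 p_pr pq x2q).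
Qed.

(** The product in ['F_p] is reduced modulo [p], which is harmless because [p] kills [x] when its
    last coordinate vanishes. *)
Lemma triple_mulrnM x (a b : 'F_p) : x.2 = 0 -> x *+ (a * b)%R = x *+ a *+ b.
Proof.
have mulM (z : 'F_p) : z *+ (a * b)%R = z *+ a *+ b by rewrite !mulrn_Fp mulrA.
by move=> x0; rewrite !triple_mulrn x0 !mulM !mul0rn.
Qed.

Lemma triple_mulrnD x (a b : 'F_p) : x.2 = 0 -> x *+ (a + b)%R = x *+ a + x *+ b.
Proof.
move=> x0; rewrite !triple_mulrn x0 !mul0rn !mulrn_Fp !mulrDr.
by congr (_, _, _); rewrite addr0.
Qed.

End Torsion.

Lemma morph_lambda (B C : leftBraceType) (f : B -> C) (x y : B) :
    {morph f : a b / a + b} -> {morph f : a b / (a * b)%g} ->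
  f (lambda x y) = lambda (f x) (f y).
Proof.
by move=> fD fM; apply: (addrI (f x)); rewrite -fD -!circ_lambda fM.
Qed.

(** * The braces B_s *)

Section BraceB.

Variables (p q : nat) (g : {unit 'F_p}).
Hypotheses (p_pr : prime p) (q_pr : prime q) (og : #[g]%g = q).

Local Notation B s := (brace_B q_pr og s).
Local Notation u := (val g : 'F_p).

Let uX1 : u ^+ q = 1 := val_expgX1 og.

Lemma lambda_B (s : 'F_q) (x y : B s) :
  lambda x y = (u ^+ x.2 * y.1.1, (u ^+ s) ^+ x.2 * y.1.2, y.2).
Proof.
by rewrite /lambda brace_B_circE brace_B_addE /= !addrA !addNr !add0r.
Qed.

(** The vector (1, 0, 0) is scaled by g^(a.2), so only [a.2 = 0] can act trivially, whatever [s]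
    is. *)
Lemma card_ker_lambda_B s : card_ker_lambda (B s) (p ^ 2).
Proof.
exists (enum [pred x : B s | x.2 == 0]); split; first exact: enum_uniq.
  rewrite -cardE (@eq_card _ _ [predX [predX 'F_p & 'F_p] & pred1 (0 : 'F_q)]).
    by rewrite !cardX card1 !card_Fp // muln1.
  by move=> [[x1 x2] x3].
move=> a; rewrite mem_enum inE; split=> [/eqP a0 [[b1 b2] b3] | /(_ (1, 0, 0))].
  by rewrite lambda_B a0 !mul1r.
rewrite lambda_B => /(congr1 (fun x : B s => x.1.1)) /=; rewrite mulr1 => ga.
by apply/eqP; apply: (expr_Fp_inj q_pr (val_prim_root q_pr og)).
Qed.

Lemma bi_skew_B s : bi_skew (B s).
Proof.
(* One coordinate of a + (b o c) = (a + b) o a^-1 o (a + c). The scaling depends only on the last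
   coordinate, where the two operations agree, so both powers on the right reduce to [w ^+ j] and
   the terms in [x] they produce cancel. *)
have law (w x y z : 'F_p) (i j : 'F_q) : w ^+ q = 1 ->
    x + (y + w ^+ j * z) =
    x + y + w ^+ (i + j)%R * - (w ^+ (- i)%R * x) + w ^+ (i + j - i)%R * (x + z).
  move=> wq; rewrite mulrN mulrA -expr_Fp_add // [i + j - i]addrAC subrr add0r.
  by rewrite mulrDr !addrA addrNK.
move=> a b c; rewrite !brace_B_addE !brace_B_circE /=; congr (_, _, _).
- exact: law.
- by apply: law; apply: expr_Fp_expn.
by rewrite !addrA [a.2 + b.2]addrC addrK -addrA addrCA !addrA.
Qed.

(** * The parameter up to inversion as an isomorphism invariant *)

Section IsoParameter.

Variables (s t : 'F_q) (f : B s -> B t).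
Hypotheses (f_bij : bijective f) (fD : {morph f : x y / x + y}).
Hypothesis fM : {morph f : x y / (x * y)%g}.

Let sig : B s := (1, 0, 0).
Let tau : B s := (0, 1, 0).
Let eps : B s := (0, 0, 1).

Let f_inj : injective f := bij_inj f_bij.

Let f0 : f 0 = 0.
Proof. exact: (morph_addMn 0 0 fD). Qed.

Hypothesis qp : ~~ (q %| p)%N.

Let f_torsion (x : B s) : x.2 = 0 -> (f x).2 = 0.
Proof.
move=> x0; apply/eqP; rewrite -(torsion_p p_pr q_pr _ qp) -[f x *+ p](morph_addMn _ _ fD).
have /eqP-> : x *+ p == 0 by rewrite torsion_p // x0.
by rewrite f0.
Qed.

(** On the plane, [f] carries the eigenvectors [sig] and [tau] of diag(g, g^s) to eigenvectors of
    diag(g^c, g^(tc)). As their images are independent, the eigenvalues match in one of two orders: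
    c = 1 and tc = s, or tc = 1 and c = s. *)
Lemma iso_parameter : s = t \/ s * t = 1.
Proof.
have sig0 : f sig != 0 by rewrite -f0 (inj_eq f_inj).
have tau0 : f tau != 0 by rewrite -f0 (inj_eq f_inj).
set c := (f eps).2.
have eps_sig : lambda eps sig = sig *+ u.
  by rewrite lambda_B triple_mulrn /= natr_Zp !mulr0 mulr1 !mul0rn expr1.
have eps_tau : lambda eps tau = tau *+ (u ^+ s : 'F_p).
  by rewrite lambda_B triple_mulrn /= natr_Zp !mulr0 mulr1 !mul0rn expr1.
have f_eig x (d : 'F_p) : x.2 = 0 -> lambda eps x = x *+ d ->
    (u ^+ c - d) * (f x).1.1 = 0 /\ (u ^+ (t * c)%R - d) * (f x).1.2 = 0.
  move=> x0 /(congr1 f); rewrite morph_lambda // morph_addMn // lambda_B.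
  rewrite triple_mulrn !mulrn_Fp -/c expr_Fp_mul // => e.
  split; rewrite mulrBl [d * _]mulrC; apply/eqP; rewrite subr_eq0; apply/eqP.
    exact: (congr1 (fun x : B t => x.1.1) e).
  exact: (congr1 (fun x : B t => x.1.2) e).
have [s11 s12] := f_eig sig _ erefl eps_sig.
have [t11 t12] := f_eig tau _ erefl eps_tau.
(* If the determinant vanished, the columns of the adjugate would be relations between [f sig] and
   [f tau]; injectivity of [f] makes these relations trivial, and then [f tau = 0]. *)
have det0 : (f sig).1.1 * (f tau).1.2 - (f sig).1.2 * (f tau).1.1 != 0.
  apply/eqP=> det0.
  have f_lin (a b : 'F_p) :
      (f sig).1.1 * a + (f tau).1.1 * b = 0 ->
      (f sig).1.2 * a + (f tau).1.2 * b = 0 -> a = 0 /\ b = 0.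
    move=> e1 e2; have: f (a, b, 0) = 0.
      have -> : (a, b, 0) = (sig *+ a) + (tau *+ b) :> B s.
        by rewrite !triple_mulrn /= !mul0rn !natr_Zp brace_B_addE /= !addr0 add0r.
      rewrite fD !(morph_addMn _ _ fD) !triple_mulrn !f_torsion // !mul0rn !mulrn_Fp.
      by rewrite brace_B_addE /= e1 e2 addr0.
    by rewrite -[RHS]f0 => /f_inj [].
  have [t12_0 /eqP s12_0] : (f tau).1.2 = 0 /\ - (f sig).1.2 = 0.
    apply: f_lin; rewrite mulrN; first by rewrite [_ * (f sig).1.2]mulrC.
    by rewrite mulrC subrr.
  have [t11_0 /eqP s11_0] : (f tau).1.1 = 0 /\ - (f sig).1.1 = 0.
    apply: f_lin; rewrite mulrN; first by rewrite mulrC subrr.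
    by rewrite [_ * (f sig).1.1]mulrC -opprB det0 oppr0.
  case/eqP: tau0; move: t11_0 t12_0 (@f_torsion tau erefl).
  by case: (f tau) => [[x y] z] /= -> -> ->.
have zu := val_prim_root q_pr og.
have expr_eq (i j : 'F_q) (x : 'F_p) : x != 0 -> (u ^+ i - u ^+ j) * x = 0 -> i = j.
  move=> x0 /eqP; rewrite mulf_eq0 (negPf x0) orbF subr_eq0 => /eqP.
  exact: (expr_Fp_inj q_pr zu).
(* A nonzero determinant has a nonzero term; the two terms correspond to the two orders of the
   eigenvalues. *)
have [d0 | d1] : (f sig).1.1 * (f tau).1.2 != 0 \/ (f sig).1.2 * (f tau).1.1 != 0.
- apply/orP; rewrite -negb_and; apply: contra det0 => /andP[/eqP-> /eqP->].
  by rewrite subrr.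
- move: d0; rewrite mulf_eq0 negb_or => /andP[/expr_eq h1 /expr_eq h2].
  by left; have := h2 _ _ t12; rewrite (h1 c 1 s11) mulr1.
move: d1; rewrite mulf_eq0 negb_or => /andP[/expr_eq h1 /expr_eq h2].
by right; rewrite -(h2 _ _ t11) mulrC; exact: (h1 _ 1 s12).
Qed.

End IsoParameter.

(** * The presentation of the multiplicative group *)

Lemma B_expgn s (n : nat) (sig : B s := (1, 0, 0)) (tau : B s := (0, 1, 0))
    (eps : B s := (0, 0, 1)) :
  [/\ (sig ^+ n)%g = (n%:R, 0, 0), (tau ^+ n)%g = (0, n%:R, 0)
    & (eps ^+ n)%g = (0, 0, n%:R)].
Proof.
elim: n => [//|n [IHs IHt IHe]]; rewrite !expgS IHs IHt IHe !brace_B_circE /=.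
by rewrite !expr0 !mul1r ?mulr0 !addr0 !mulrS.
Qed.

(** Two halves: the unit vectors generate B_s and satisfy the relations, and every group [H]
    generated by elements satisfying them is a homomorphic image of B_s. *)
Lemma isog_G_B s : isog_G g s [set: B s].
Proof.
apply: intro_isoGrp => [|rT H].
  pose sig : B s := (1, 0, 0); pose tau : B s := (0, 1, 0).
  pose eps : B s := (0, 0, 1).
  have expn n := B_expgn s n.
  have sigp : (sig ^+ p)%g = 1%g by have [-> _ _] := expn p; rewrite pchar_Fp_0.
  have taup : (tau ^+ p)%g = 1%g by have [_ -> _] := expn p; rewrite pchar_Fp_0.
  have epsq : (eps ^+ q)%g = 1%g by have [_ _ ->] := expn q; rewrite pchar_Fp_0.
  have comm : [~ sig, tau]%g = 1%g.
    apply/eqP/commgP; rewrite /commute !brace_B_circE /= !expr0 !mul1r.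
    by rewrite !addr0 !add0r.
  have conj_sig : (eps * sig * eps^-1)%g = (sig ^+ (u : 'F_p))%g.
    apply: (canLR (mulgK eps)); have [-> _ _] := expn (u : 'F_p).
    by rewrite !brace_B_circE /= natr_Zp !mulr0 !addr0 !add0r mulr1 expr1.
  have conj_tau : (eps * tau * eps^-1)%g = (tau ^+ (u ^+ s : 'F_p)%R)%g.
    apply: (canLR (mulgK eps)); have [_ -> _] := expn (u ^+ s : 'F_p).
    by rewrite !brace_B_circE /= natr_Zp !mulr0 !addr0 !add0r mulr1 expr1.
  apply/existsP; exists (sig, tau, eps).
  rewrite /= sigp taup epsq comm conj_sig conj_tau.
  suff -> : (<[sig]> <*> <[tau]> <*> <[eps]>)%g = [set: B s] by rewrite eqxx.
  apply/eqP; rewrite -subTset; apply/subsetP=> b _.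
  have -> : b = (sig ^+ b.1.1 * tau ^+ b.1.2 * eps ^+ b.2)%g.
    have [-> _ _] := expn b.1.1; have [_ -> _] := expn b.1.2.
    have [_ _ ->] := expn b.2; rewrite !brace_B_circE /= !natr_Zp !expr0.
    by rewrite !mul1r !addr0 !add0r; case: b => [[]].
  rewrite !groupM // mem_gen // inE ?mem_cycle ?orbT // mem_gen //.
    by rewrite inE mem_cycle.
  by rewrite inE mem_cycle orbT.
case/existsP=> [[[x y] z]] /= /eqP[defH xp yp zq xy zx zy].
have {}xy : commute x y by apply/commgP/eqP.
(* The coordinates of [b] become the exponents of a normal form in the generators of [H]. *)
pose f (b : B s) := (x ^+ b.1.1 * y ^+ b.1.2 * z ^+ b.2)%g.
(* Moving [z ^+ k] to the right past a power of [w] multiplies its exponent by [v ^+ k]; this is the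
   scaling in the definition of o. *)
have conj_exp (w : rT) (v a : 'F_p) (k : nat) : (w ^+ p)%g = 1%g ->
    (z * w * z^-1)%g = (w ^+ v)%g ->
    (z ^+ k * w ^+ a = w ^+ (v ^+ k * a)%R * z ^+ k)%g.
  move=> wp zw; elim: k a => [|k IHk] a; first by rewrite mul1r mulg1 mul1g.
  have zwX m : (z * w ^+ m = w ^+ (v * m) * z)%g.
    have zw1 : (z * w = w ^+ v * z)%g by rewrite -zw mulgKV.
    elim: m => [|m IHm]; first by rewrite muln0 mulg1 mul1g.
    by rewrite expgS mulgA zw1 -mulgA IHm mulnS expgD mulgA.
  by rewrite expgS -mulgA IHk mulgA zwX -mulgA exprS -mulrA expg_Fp_mul // expgM.
have fM : {in [set: B s] &, {morph f : a b / (a * b)%g}}.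
  move=> a b _ _; transitivity (x ^+ (a.1.1 + u ^+ a.2 * b.1.1)%R *
      y ^+ (a.1.2 + (u ^+ s) ^+ a.2 * b.1.2)%R * z ^+ (a.2 + b.2)%R)%g => //.
  rewrite !expg_Fp_add // /f -!mulgA; congr (_ * _)%g.
  rewrite [(z ^+ a.2 * (x ^+ _ * _))%g]mulgA (conj_exp x u) // -!mulgA.
  rewrite [(z ^+ a.2 * (y ^+ _ * _))%g]mulgA (conj_exp y (u ^+ s)) // !mulgA.
  by rewrite (commuteX2 a.1.2 (u ^+ a.2 * b.1.1 : 'F_p)%R (commute_sym xy)).
apply/homgP; exists (Morphism fM); apply/eqP; rewrite eqEsubset.
apply/andP; split.
  apply/subsetP=> _ /morphimP[b _ _ ->]; rewrite -defH /= /f.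
  rewrite !groupM // mem_gen // inE ?mem_cycle ?orbT // mem_gen //.
    by rewrite inE mem_cycle.
  by rewrite inE mem_cycle orbT.
have fE (b : B s) : f b \in (Morphism fM @* [set: B s])%g.
  by apply/morphimP; exists b; rewrite ?inE.
rewrite -defH !join_subG !cycle_subG -andbA; apply/and3P; split.
- by have := fE (1, 0, 0); rewrite /f /= expg1 !mulg1.
- by have := fE (0, 1, 0); rewrite /f /= expg1 mul1g mulg1.
by have := fE (0, 0, 1); rewrite /f /= expg1 !mul1g.
Qed.

End BraceB.

(** * Classification *)

(* Lagrange: translation by x permutes K, so the sum over K absorbs size K copies
   of x. *)
Lemma mulrn_size_addr_closed (V : zmodType) (K : seq V) (x : V) : uniq K ->
  {in K &, forall y z, y + z \in K} -> x \in K -> x *+ size K = 0.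
Proof.
move=> Ku KD Kx; apply: (addIr (\sum_(y <- K) y)); rewrite add0r.
have xKu : uniq [seq x + y | y <- K] by rewrite map_inj_uniq //; apply: addrI.
have xK_K : {subset [seq x + y | y <- K] <= K}.
  by move=> _ /mapP[y Ky ->]; apply: KD.
have [|_ xK] := uniq_min_size xKu xK_K; first by rewrite size_map.
rewrite -[in RHS](perm_big _ (uniq_perm xKu Ku xK)) big_map big_split /=.
by rewrite big_const_seq count_predT iter_addr_0.
Qed.

(** [M] is annihilated by X^q - 1, which has the distinct roots z^i, so [M] is diagonalizable. The
    rows of [P] are nonzero eigenvectors, whence each eigenvalue is a [q]-th root of unity. *)
Lemma diagonal_prim_root (F : fieldType) (q n : nat) (z : F) (M : 'M[F]_n.+1) :
    q.-primitive_root z -> M ^+ q = 1 ->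
  exists P d, [/\ P \in unitmx, forall i, row i P *m M = d i *: row i P &
                  forall i : 'I_n.+1, d i ^+ q = 1].
Proof.
move=> zq Mq; have [P Pu /diagonalizable_forPex[d PMd]] : diagonalizable M.
  apply/diagonalizableP; exists [seq z ^+ i | i <- index_iota 0 q].
    rewrite map_inj_in_uniq ?iota_uniq // => i j; rewrite !mem_index_iota /=.
    by move=> iq jq /eqP; rewrite (eq_prim_root_expr zq) !modn_small // => /eqP.
  rewrite big_map factor_Xn_sub_1 //; apply/mxminpoly_minP.
  by rewrite rmorphB rmorphXn /= horner_mx_X rmorph1 Mq subrr.
have PM i : row i P *m M = d 0 i *: row i P.
  by rewrite -row_mul (simmxPp (stablemx_unit _ Pu) PMd) row_mul row_diag_mx
    -scalemxAl -rowE.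
exists P, (d 0); split=> // i.
have PMX k : row i P *m M ^+ k = d 0 i ^+ k *: row i P.
  elim: k => [|k IHk]; first by rewrite mulmx1 scale1r.
  by rewrite exprS mulmxA PM -scalemxAl IHk scalerA exprS.
have /eqP := PMX q; rewrite Mq mulmx1 -subr_eq0 -{1}[row i P]scale1r -scalerBl.
rewrite scaler_eq0 subr_eq0 => /orP[/eqP<- //|].
by rewrite rowE mulmx_free_eq0 ?row_free_unit // => /eqP/matrixP/(_ 0 i);
  rewrite !mxE !eqxx => /eqP; rewrite oner_eq0.
Qed.

Section Classification.

Variables (p q : nat) (g : {unit 'F_p}).
Hypotheses (p_pr : prime p) (q_pr : prime q) (og : #[g]%g = q).
Hypotheses (qp : ~~ (q %| p)%N) (pq : ~~ (p %| q)%N).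

Local Notation T := ('F_p * 'F_p * 'F_q)%type.
Local Notation u := (val g : 'F_p).
Implicit Types a b x y w : T.

(* L is the map lambda of a brace transported to T along an additive isomorphism;
   LM says that lambda is multiplicative for a o b = a + L a b. *)
Variable L : T -> T -> T.
Hypotheses (LD : forall a, {morph L a : b c / b + c}).
Hypotheses (L_inj : forall a, injective (L a)).
Hypothesis LM : forall a b c, L (a + L a b) c = L a (L b c).

Let ker : {set T} := [set a | [forall b, L a b == b]].
Hypothesis card_ker : #|ker| = (p ^ 2)%N.

Local Notation e k := ((0, 0, k) : T).
Local Notation A := (L (e 1)).

Let kerP a : reflect (L a =1 id) (a \in ker).
Proof. by rewrite inE; apply: (iffP forallP) => h b; apply/eqP/h. Qed.

(** On the kernel the transported o is addition, so the kernel is closed under addition and p^2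
    kills it. Its last coordinates then vanish, and counting gives equality with the plane. *)
Lemma action_ker a : (a \in ker) = (a.2 == 0).
Proof.
have kerD : {in ker &, forall a b, a + b \in ker}.
  move=> x y /kerP Lx /kerP Ly; apply/kerP=> z.
  by rewrite -{1}(Lx y) LM Ly Lx.
have sub_ker : ker \subset [set x | x.2 == 0].
  apply/subsetP=> x kx; rewrite inE.
  have xp : x *+ (p ^ 2) = 0.
    rewrite -card_ker cardE; apply: mulrn_size_addr_closed; rewrite ?enum_uniq //.
      by move=> y z; rewrite !mem_enum; apply: kerD.
    by rewrite mem_enum.
  apply/eqP; apply: (@mulrn_Fp_eq0 q q_pr _ (p ^ 2)).
    by rewrite Euclid_dvdX // (negPf qp).
  by move/(congr1 snd): xp; rewrite triple_mulrn.
suff -> : ker = [set x | x.2 == 0] by rewrite inE.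
apply/eqP; rewrite eqEcard sub_ker card_ker.
rewrite (@eq_card _ _ [predX [predX 'F_p & 'F_p] & pred1 (0 : 'F_q)]).
  by rewrite !cardX card1 !card_Fp // muln1 mulnn leqnn.
by move=> [[x1 x2] x3]; rewrite inE.
Qed.

(** Split [a] as a plane vector, which acts trivially, plus an axis vector; [LM] makes the action of
    the sum a composite. *)
Lemma action_snd a : L a =1 L (e a.2).
Proof.
move=> b; have /kerP Lv : ((a.1, 0) : T) \in ker by rewrite action_ker.
rewrite -[RHS]Lv -LM Lv; congr (L _ b).
case: a {Lv} => [[a1 a2] a3]; congr (_, _, _); rewrite /= ?addr0 ?add0r //.
Qed.

Lemma action_torsion a b : b.2 = 0 -> (L a b).2 = 0.
Proof.
move=> b0; apply/eqP; rewrite -(torsion_p p_pr q_pr _ qp) -(morph_addMn _ _ (LD a)).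
have /eqP-> : b *+ p == 0 by rewrite torsion_p // b0.
by rewrite (morph_addMn 0 0 (LD a)).
Qed.

Lemma action0 : L 0 =1 id.
Proof. by apply/kerP; rewrite action_ker. Qed.

Lemma axisD k l : e k + e l = e (k + l).
Proof. by congr (_, _, _); rewrite addr0. Qed.

(** Permutations of the finite type [T] let Lagrange's theorem apply to the image of [L]. *)
Let P (k : 'F_q) : {perm T} := perm (@L_inj (e k)).

(* If P k = P l, the b with (e k) o b = e l acts trivially, so it lies in the kernel
   and does not change the last coordinate. *)
Let P_inj : injective P.
Proof.
move=> k l Pkl; pose b := ((P k)^-1)%g (e (l - k)).
have Lb : L (e k) b = e (l - k) by have := permKV (P k) (e (l - k)); rewrite permE.
have : b \in ker.
  apply/kerP=> c; apply: (@L_inj (e k)); rewrite -LM Lb.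
  rewrite [RHS](_ : _ = L (e l) c); last by have /permP/(_ c) := Pkl; rewrite !permE.
  by rewrite axisD addrC subrK.
rewrite action_ker => /eqP /(action_torsion (e k)); rewrite Lb => /eqP.
by rewrite subr_eq0 => /eqP.
Qed.

(** The image of [L] consists of the [P k]; it is closed under composition and has [q] elements by
    [P_inj], so the order of [A] divides [q]. *)
Lemma iter_axis_card : iter q A =1 id.
Proof.
have PM k l : (P k * P l)%g = P (l + (L (e l) (e k)).2).
  by apply/permP=> x; rewrite permM !permE -LM action_snd.
have P_group : group_set [set P k | k : 'F_q].
  apply/group_setP; split=> [|_ _ /imsetP[k _ ->] /imsetP[l _ ->]].
    by apply/imsetP; exists 0 => //; apply/permP=> x; rewrite perm1 permE action0.
  by rewrite PM imset_f.
move=> x; rewrite /id -[RHS]perm1.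
rewrite -(expg_cardG (G := Group P_group) (a := P 1)) ?imset_f //=.
rewrite card_imset // card_Fp // permX.
by apply: eq_iter => y; rewrite permE.
Qed.

(** The axis is the [q]-torsion, hence stable under [A], which multiplies it by some [c]. Now c^q =
    1 because A^q = id, while c^q = c by Fermat, so c = 1. *)
Lemma axis_fixed k : A (e k) = e k.
Proof.
have Ae1 : A (e 1) = e (A (e 1)).2.
  have : (A (e 1)).1 == 0.
    rewrite -(torsion_q p_pr q_pr _ pq) -(morph_addMn _ _ (LD _)).
    have /eqP-> : (e 1 : T) *+ q == 0 by rewrite torsion_q.
    by rewrite (morph_addMn 0 0 (LD _)).
  by case: (A (e 1)) => [x1 x2] /= /eqP->.
set c := (A (e 1)).2 in Ae1.
have Ae l : A (e l) = e (c * l).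
  have -> : e l = e 1 *+ l by rewrite triple_mulrn /= !mul0rn natr_Zp.
  by rewrite (morph_addMn _ _ (LD _)) Ae1 triple_mulrn /= !mul0rn mulrn_Fp.
have iterA n : iter n A (e 1) = e (c ^+ n).
  by elim: n => [|n IHn] //; rewrite iterS IHn Ae exprS.
have := iter_axis_card (e 1); rewrite iterA Fp_expn // => /(congr1 snd) /= c1.
by rewrite Ae c1 mul1r.
Qed.

(** As [A] fixes the axis, o restricts to addition there, so [L] is determined by [A]. *)
Lemma iter_axis (k : 'F_q) : iter k A =1 L (e k).
Proof.
move=> x; rewrite -[in RHS](natr_Zp k).
elim: (k : nat) => [|n IHn]; first by rewrite action0.
by rewrite iterS IHn -LM axis_fixed axisD mulrS.
Qed.

(** * Recovering B_s from an eigenbasis of [A] *)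

Section Eigenbasis.

Variables (s a : 'F_q) (w1 w2 : T).
Hypotheses (a0 : a != 0) (w1_0 : w1.2 = 0) (w2_0 : w2.2 = 0).
Hypothesis Aw1 : A w1 = w1 *+ (u ^+ a : 'F_p).
Hypothesis Aw2 : A w2 = w2 *+ (u ^+ (a * s)%R : 'F_p).
Hypothesis w_free : forall x y : 'F_p,
  w1 *+ x + w2 *+ y = 0 -> x = 0 /\ y = 0.

Lemma action_eigen w (d : 'F_p) (k : 'F_q) : w.2 = 0 -> A w = w *+ d ->
  L (e k) w = w *+ (d ^+ k : 'F_p).
Proof.
move=> w0 Aw; rewrite -iter_axis; elim: (k : nat) => [//|n IHn].
rewrite iterS IHn (morph_addMn _ _ (LD _)) Aw exprS triple_mulrnM //.
Qed.

Lemma eigenbasis_iso : exists f : brace_B q_pr og s -> T,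
  [/\ bijective f, {morph f : x y / x + y} &
      forall x y : brace_B q_pr og s, f (lambda x y) = L (f x) (f y)].
Proof.
(* The factor [a^-1] on the axis replaces [A] by its power with exponent 1/a, whose eigenvalues on
   [w1] and [w2] are g and g^s. *)
pose f (x : T) : T := w1 *+ x.1.1 + w2 *+ x.1.2 + e (a^-1 * x.2).
have fD : {morph f : x y / x + y}.
  move=> x y; rewrite /f !triple_mulrnD // mulrDr -axisD [RHS]addrACA.
  by congr (_ + _); apply: addrACA.
have f2 x : (f x).2 = a^-1 * x.2.
  by rewrite /f !triple_mulrn w1_0 w2_0 !mul0rn /= !add0r.
have uX1 := val_expgX1 og.
exists f; split=> //.
  apply: (@injF_bij T f) => x y fxy; apply/eqP; rewrite -subr_eq0; apply/eqP.
  have : f (x - y) = 0 by apply: (addIr (f y)); rewrite -fD subrK add0r.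
  case: (x - y) => {x y fxy} [[z1 z2] z3] fz0; have z3_0 : z3 = 0.
    by apply: (mulfI (invr_neq0 a0)); rewrite -[LHS](f2 (z1, z2, z3)) fz0 mulr0.
  by move: fz0; rewrite /f z3_0 /= mulr0 addr0 => /w_free[-> ->].
have L_axis k l : L (e k) (e l) = e l.
  by rewrite -iter_axis; elim: (k : nat) => [//|n IHn]; rewrite iterS IHn axis_fixed.
move=> x y; rewrite action_snd f2 lambda_B; transitivity (w1 *+ (u ^+ x.2 * y.1.1)%R +
    w2 *+ ((u ^+ s) ^+ x.2 * y.1.2)%R + e (a^-1 * y.2)) => //.
rewrite [f y]/f !LD L_axis !(morph_addMn _ _ (LD _)).
rewrite (action_eigen _ w1_0 Aw1) (action_eigen _ w2_0 Aw2).
rewrite -!expr_Fp_mul // !triple_mulrnM //.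
by rewrite mulVKf // mulrAC mulVKf // [x.2 * s]mulrC.
Qed.

End Eigenbasis.

Lemma action_classification (K : {set 'F_q}) : parameter_set K ->
  exists2 s, s \in K & exists f : brace_B q_pr og s -> T,
  [/\ bijective f, {morph f : x y / x + y} &
      forall x y : brace_B q_pr og s, f (lambda x y) = L (f x) (f y)].
Proof.
case=> K0 K1 KN1 Kinv.
have zu := val_prim_root q_pr og.
(* [v] and [toV] identify row vectors with the plane, so that [A] becomes right multiplication by a
   matrix [M]. *)
pose v (r : 'rV['F_p]_2) : T := (r 0 0, r 0 1, 0).
have vD : {morph v : r r' / r + r'}.
  by move=> r r'; rewrite /v !mxE; congr (_, _, _); rewrite addr0.
have v_inj r r' : v r = v r' -> r = r'.
  move=> rr'; have r0 := congr1 (fun x : T => x.1.1) rr'.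
  have r1 := congr1 (fun x : T => x.1.2) rr'.
  apply/rowP=> i; case: (unliftP 0 i) => [j|] -> //.
  by rewrite [j]ord1 (_ : lift 0 0 = 1) //; apply: val_inj.
have vZ (x : 'F_p) r : v (x *: r) = v r *+ x.
  by rewrite triple_mulrn /v !mxE !mulrn_Fp mul0rn ![x * _]mulrC.
pose toV (x : T) : 'rV['F_p]_2 := \row_i (if i == 0 then x.1.1 else x.1.2).
have toVK x : x.2 = 0 -> v (toV x) = x.
  by case: x => [[x1 x2] x3] /= ->; rewrite /v !mxE.
pose M := \matrix_(i < 2) toV (A (v (delta_mx 0 i))).
have AM r : A (v r) = v (r *m M).
  rewrite {1}[r]row_sum_delta mulmx_sum_row !big_ord_recl !big_ord0 !addr0.
  by rewrite !vD LD !vZ !(morph_addMn _ _ (LD _)) !rowK !toVK // action_torsion.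
have Mq : M ^+ q = 1.
  have iterM n r : iter n A (v r) = v (r *m M ^+ n).
    elim: n r => [|n IHn] r; first by rewrite mulmx1.
    by rewrite iterS IHn AM -mulmxA exprSr.
  apply/row_matrixP=> i; rewrite !rowE mulmx1; apply: v_inj.
  by rewrite -iterM iter_axis_card.
have [B [d [Bu BM dq]]] := diagonal_prim_root zu Mq.
have /fin_all_exists[a da] i := expr_Fp_surj q_pr zu (dq i).
(* If both exponents vanished, [A] would fix the plane as well as the axis, and [e 1] would lie in
   the kernel. *)
have a_neq0 : (a 0 != 0) || (a 1 != 0).
  rewrite -negb_and; apply/negP=> /andP[/eqP a00 /eqP a10].
  have BM_B : B *m M = B.
    apply/row_matrixP=> i; rewrite row_mul BM da.
    suff -> : a i = 0 by rewrite scale1r.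
    by case: (unliftP 0 i) => [j|] -> //; rewrite [j]ord1 -[RHS]a10;
      congr (a _); apply: val_inj.
  have M1 : M = 1 by apply: (can_inj (mulKmx Bu)); rewrite BM_B mulmx1.
  have : e 1 \in ker.
    apply/kerP=> x; have -> : x = v (toV (x.1, 0)) + e x.2.
      rewrite toVK //; case: x => [[x1 x2] x3].
      by congr (_, _, _); rewrite ?addr0 ?add0r.
    by rewrite LD axis_fixed AM M1 mulmx1.
  by rewrite action_ker oner_eq0.
(* The eigenvectors are ordered so that the ratio of exponents falls in [K]: a zero exponent goes in
   the numerator, and otherwise swapping inverts the ratio. *)
have [i [j [ij ai0 Ks]]] : exists i j : 'I_2, [/\ i != j, a i != 0 & a j / a i \in K].
  have [a00 | a00] := eqVneq (a 0) 0.
    by exists 1, 0; split; rewrite // ?a00 ?mul0r //; rewrite a00 eqxx in a_neq0.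
  have [aK | aK] := boolP (a 1 / a 0 \in K); first by exists 0, 1.
  have a_0 : a 1 / a 0 != 0 by apply: contraNneq aK => ->.
  have a_1 : a 1 / a 0 != 1 by apply: contraNneq aK => ->.
  have a_N1 : a 1 / a 0 != -1 by apply: contraNneq aK => ->.
  have := Kinv _ a_0 a_1 a_N1; rewrite (negPf aK) invf_div /= => aK'.
  exists 1, 0; split=> //.
  by apply: contraNneq a_0 => ->; rewrite mul0r.
exists (a j / a i) => //.
apply: (@eigenbasis_iso _ (a i) (v (row i B)) (v (row j B))) => //.
- by rewrite AM BM vZ da.
- by rewrite AM BM vZ da mulrC divfK.
(* Rows [i] and [j] are independent because the eigenvector matrix is invertible. *)
move=> x y; rewrite -!vZ -vD -(morph_addMn 0 0 vD : v 0 = 0) => /v_inj.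
rewrite !rowE !scalemxAl -mulmxDl => /eqP; rewrite mulmx_free_eq0 ?row_free_unit //.
move=> /eqP/rowP xy; have := xy i; have := xy j.
rewrite !mxE !eqxx /= (negPf ij) [j == i]eq_sym (negPf ij) !mulr1 !mulr0.
by rewrite addr0 add0r.
Qed.

End Classification.

(** Since a o b = a + [lambda a b], an additive bijection commuting with [lambda] also preserves o;
    the isomorphism sought is its inverse. *)
Lemma brace_isom_lambda (B C : leftBraceType) (f : C -> B) :
    bijective f -> {morph f : x y / x + y} ->
    (forall x y, f (lambda x y) = lambda (f x) (f y)) ->
  brace_isom B C.
Proof.
move=> [f' fK f'K] fD fL.
have fM : {morph f : x y / (x * y)%g} by move=> x y; rewrite !circ_lambda fD fL.
exists f'; split; first by exists f.
  by move=> x y; apply: (can_inj fK); rewrite fD !f'K.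
by move=> x y; apply: (can_inj fK); rewrite fM !f'K.
Qed.

(** [lambda] is transported to the triples along the additive isomorphism [f] and classified there;
    composing with [f'] brings the result back to [B]. *)
Lemma brace_classification (p q : nat) (p_pr : prime p) (q_pr : prime q)
    (g : {unit 'F_p}) (og : #[g]%g = q) (K : {set 'F_q}) (B : leftBraceType) :
    ~~ (q %| p)%N -> parameter_set K ->
    zmod_isom B ('F_p * 'F_p * 'F_q)%type -> card_ker_lambda B (p ^ 2) ->
  exists2 s : 'F_q, s \in K & brace_isom B (brace_B q_pr og s).
Proof.
move=> qp K_param [f [f' fK f'K]] [N [N_uniq N_size N_ker]].
have pq : ~~ (p %| q)%N.
  by apply: contra qp; rewrite dvdn_prime2 // => /eqP->.
have f'D : {morph f' : x y / x + y}.
  by move=> x y; apply: (can_inj fK); rewrite raddfD !f'K.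
pose L (a b : 'F_p * 'F_p * 'F_q) := f (lambda (f' a) (f' b)).
have LD a : {morph L a : b c / b + c}.
  by move=> b c; rewrite /L f'D lambdaD raddfD.
have L_inj a : injective (L a).
  by move=> b c /(can_inj fK) /lambda_inj /(can_inj f'K).
have LM a b c : L (a + L a b) c = L a (L b c).
  by rewrite /L f'D !fK -circ_lambda lambdaM.
have card_ker : #|[set a | [forall b, L a b == b]]| = (p ^ 2)%N.
  rewrite -N_size -(size_map f) -(card_uniqP _) ?map_inj_uniq //; last exact: can_inj fK.
  apply: eq_card => a; rewrite -[a]f'K mem_map; last exact: can_inj fK.
  rewrite inE; apply/forallP/idP => [La | /N_ker La b].
    apply/N_ker=> b; apply: (can_inj fK).
    by have /eqP := La (f b); rewrite /L !fK.
  by rewrite /L fK La f'K.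
have [s Ks [h [h_bij hD hL]]] :=
  action_classification p_pr q_pr og qp pq LD L_inj LM card_ker K_param.
exists s => //; apply: (@brace_isom_lambda _ _ (f' \o h)).
- by apply: bij_comp => //; exists f.
- by move=> x y; rewrite /= hD f'D.
by move=> x y; rewrite /= hL /L fK.
Qed.

Theorem theorem3p7 (p q : nat) (p_pr : prime p) (q_pr : prime q)
    (p_mod_q : p = 1 %[mod q]) (g : {unit 'F_p}) (og : #[g]%g = q)
    (K : {set 'F_q}) (K_param : parameter_set K) :
  [/\ forall s : 'F_q, s \in K ->
        zmod_isom (brace_B q_pr og s) ('F_p * 'F_p * 'F_q)%type /\
        card_ker_lambda (brace_B q_pr og s) (p ^ 2),
      forall B : leftBraceType,
        zmod_isom B ('F_p * 'F_p * 'F_q)%type ->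
        card_ker_lambda B (p ^ 2) ->
        exists2 s : 'F_q, s \in K & brace_isom B (brace_B q_pr og s),
      forall s t : 'F_q, s \in K -> t \in K ->
        brace_isom (brace_B q_pr og s) (brace_B q_pr og t) -> s = t &
      forall s : 'F_q, s \in K ->
        isog_G g s [set: brace_B q_pr og s] /\ bi_skew (brace_B q_pr og s)].
Proof.
have qp := modn1_ndvd q_pr p_mod_q.
split=> [s _ | B | s t Ks Kt [f [f_bij fD fM]] | s _].
- by split; [exists idfun; exists idfun | exact: card_ker_lambda_B].
- exact: brace_classification.
- have [// | st] := iso_parameter p_pr f_bij fD fM qp.
  have s0 : s != 0 by apply: contra_eq_neq st => ->; rewrite mul0r eq_sym oner_eq0.
  have tE : t = s^-1 by rewrite -[RHS]mulr1 -st mulKf.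
  (* Both [s] and its inverse lie in [K], which the exclusive or forbids unless [s] is 1 or -1, and
     these are their own inverses. *)
  case: K_param => _ _ _ /(_ s s0); rewrite Ks -tE Kt tE.
  have [-> | _] := eqVneq s 1; first by rewrite invr1.
  have [-> | _] := eqVneq s (-1); first by rewrite invrN1.
  by move/(_ isT isT).
by split; [exact: isog_G_B | exact: bi_skew_B].
Qed.
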